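(* Let $r\geq 2$, $n\geq r$ and $m\geq t_r(n)$, and let $G$ be a graph with $n$ vertices and $m$ edges which is not regular. Then there exists a $\mathfrak{P}$-sequence of $G$ whose first $r$ terms $v_1,\dots,v_r$ satisfy $$\sum_{i=1}^{r} d(v_i)>\frac{2rm}{n}.$$
   Context: Graphs are finite and simple. $d(u)$ denotes the degree of a vertex $u$ and $\Gamma(u)$ its neighbourhood; for a set $U$ of vertices, $\widehat{\Gamma}(U)=\bigcap_{v\in U}\Gamma(v)$. $t_r(n)$ is the number of edges of the $r$-partite Turán graph on $n$ vertices (complete $r$-partite graph with part sizes differing by at most one). The greedy algorithm $\mathfrak{P}$ constructs a clique $v_1,\dots,v_k$ in $G$: $v_1$ is a vertex of maximum degree in $G$; having selected $v_1,\dots,v_{i-1}$, if $\widehat{\Gamma}(\{v_1,\dots,v_{i-1}\})=\varnothing$ it stops, otherwise it selects $v_i$ to be a vertex of maximum degree (in $G$) among the vertices of $\widehat{\Gamma}(\{v_1,\dots,v_{i-1}\})$, and repeats. Any sequence that can be produced by $\mathfrak{P}$ (with arbitrary tie-breaking) is called a $\mathfrak{P}$-sequence. *)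

(* Defs.v *)
From mathcomp Require Import all_boot all_order all_algebra.

Set Implicit Arguments.
Unset Strict Implicit.
Unset Printing Implicit Defensive.

(* A finite simple graph is a relation e : rel T on T : finType that is
   symmetric and irreflexive (hypotheses of the statement). *)

Section Graphs.
Variables (T : finType) (e : rel T).

Definition nbhd (u : T) : {set T} := [set w | e u w].

Definition degree (u : T) : nat := #|nbhd u|.

Definition edge_set : {set {set T}} :=
  [set [set p.1; p.2] | p : T * T & e p.1 p.2].

Definition num_edges : nat := #|edge_set|.

Definition regular : Prop := exists d : nat, forall u : T, degree u = d.

(* The empty intersection is the whole vertex set: common_nbhd set0 = setT. *)
Definition common_nbhd (U : {set T}) : {set T} := \bigcap_(v in U) nbhd v.

(* Since common_nbhd set0 = setT, the first selection (U = set0) is that of a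
   vertex of maximum degree in the whole graph. *)
Definition greedy_choice (U : {set T}) (v : T) : bool :=
  (v \in common_nbhd U) &&
  [forall w in common_nbhd U, degree w <= degree v].

(* greedy_from U s: having already selected U, the algorithm may select the
   terms of s, in this order, and then stop. *)
Fixpoint greedy_from (U : {set T}) (s : seq T) : bool :=
  if s is v :: s' then greedy_choice U v && greedy_from (v |: U) s'
  else common_nbhd U == set0.

Definition P_sequence (s : seq T) : bool := greedy_from set0 s.

End Graphs.

(* For r > 0 the classes of the Turan graph are the residue classes modulo r
   in {0, ..., n-1}, whose sizes differ by at most one (turan_part_size). *)
Definition turan_rel (r n : nat) : rel 'I_n :=
  fun i j => i %% r != j %% r.
Arguments turan_rel : clear implicits.

Definition turan_number (r n : nat) : nat := num_edges (turan_rel r n).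

Lemma turan_part_size (r n k : nat) : k < r ->
  #|[set i : 'I_n | i %% r == k]| = n %/ r + (k < n %% r).
Proof.
move=> kr; have r0 : 0 < r by apply: leq_ltn_trans kr.
rewrite cardsE -sum1_card.
transitivity (\sum_(0 <= i < n | i %% r == k) 1); first by rewrite big_mkord.
elim: n => [|n IHn]; first by rewrite big_geq // div0n mod0n.
rewrite big_mkcond big_nat_recr //= -big_mkcond /= IHn.
have ltm : n %% r < r by rewrite ltn_mod.
have [E|N] := eqVneq (n %% r).+1 r.
  have dv : n.+1 = (n %/ r).+1 * r.
    by rewrite {1}(divn_eq n r) -addnS E mulSn addnC.
  rewrite dv mulnK // modnMl ltn0 addn0.
  move: kr; rewrite -{1}E ltnS leq_eqVlt (eq_sym k).
  by case: eqP => [->|_ /= ->]; rewrite ?ltnn ?addn0 ?addn1.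
have lt : (n %% r).+1 < r by rewrite ltn_neqAle N.
have dv : n.+1 = n %/ r * r + (n %% r).+1 by rewrite addnS -divn_eq.
rewrite [in RHS]dv divnMDl // modnMDl (modn_small lt) (divn_small lt) addn0.
rewrite ltnS [k <= _]leq_eqVlt (eq_sym k) -addnA; congr (_ + _).
by case: eqP => [->|_]; rewrite ?ltnn //= addn0.
Qed.

(* Main.v *)
(* Work with codegrees x(u) = n - d(u). Charging each vertex u to the first of
   v_1, ..., v_j to which it is not adjacent (to v_j if there is none among
   v_1, ..., v_{j-1}) charges at most x(v_i) vertices to v_i for i < j, each
   of codegree at least x(v_i). As x(v_1) <= ... <= x(v_j), this gives
     sum_{i<j} x(v_i)^2 + (n - sum_{i<j} x(v_i)) x(v_j) <= sum_u x(u),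
   and the right-hand side n^2 - 2m is at most the sum of the squared class
   sizes of the Turan graph. Since those sizes take only the consecutive values
   q and q + 1, integrality of the x(v_i) yields, by induction on j, that
   x(v_1) + ... + x(v_j) is at most the total size of the j smallest classes;
   so the sequence has at least r terms, and the first r codegrees sum to at
   most n. Substituting this into the inequality for j = r and applying
   Cauchy-Schwarz gives r sum_u x(u) >= n sum_{i<=r} x(v_i), with equality only
   if all x(v_i) are equal, in which case the mean codegree is the minimum one
   and G is regular. Hence every greedy sequence works. *)

Require Import Defs.
From mathcomp Require Import all_boot all_order all_algebra.
From mathcomp Require Import zify ring.

Set Implicit Arguments.
Unset Strict Implicit.
Unset Printing Implicit Defensive.

Import Order.TTheory GRing.Theory Num.Theory.

(** * Double counting of edges *)

Lemma sum_degree (T : finType) (e : rel T) :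
  symmetric e -> irreflexive e -> \sum_u degree e u = 2 * num_edges e.
Proof.
move=> esym eirr.
pose E := [set p : T * T | e p.1 p.2].
have -> : \sum_u degree e u = #|E|.
  rewrite -sum1_card (eq_bigl (fun p : T * T => e p.1 p.2)); last first.
    by move=> p; rewrite inE.
  rewrite -(pair_big_dep xpredT (fun u v => e u v) (fun _ _ => 1)) /=.
  apply: eq_bigr => u _.
  by rewrite /degree -sum1_card; apply: eq_bigl => v; rewrite inE.
have edgeE : edge_set e = [set [set p.1; p.2] | p in E].
  by apply: eq_imset => // p; rewrite !inE.
(* The fibre over an edge consists of its two orientations. *)
rewrite -sum1_card (partition_big_imset (fun p => [set p.1; p.2])) /= -edgeE.
rewrite mulnC /num_edges -sum_nat_const; apply: eq_bigr => A.
rewrite edgeE => /imsetP[[u v]]; rewrite inE /= => euv ->.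
have uv : u != v by apply/eqP => uv; move: euv; rewrite uv eirr.
have -> : 2 = #|pred2 (u, v) (v, u)| by rewrite card2 xpair_eqE (negbTE uv).
rewrite sum1_card.
apply: eq_card => -[a b]; rewrite !inE !xpair_eqE /=.
apply/andP/orP => [[]|[]/andP[/eqP-> /eqP->]]; last 2 first.
- by rewrite inE.
- by rewrite inE /= esym setUC.
rewrite inE /= => eab /eqP abE.
have : a \in [set u; v] by rewrite -abE set21.
have : b \in [set u; v] by rewrite -abE set22.
rewrite !inE => /orP[]/eqP bE /orP[]/eqP aE; move: eab; rewrite bE aE ?eirr //.
- by right; rewrite !eqxx.
by left; rewrite !eqxx.
Qed.

(** * Greedy sequences in terms of codegrees *)

Section Greedy.
Variables (T : finType) (e : rel T).
Hypothesis eirr : irreflexive e.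

(** The complement contains [u] itself, so in a Turan graph this is the size of the class of [u]. *)
Definition codegree (u : T) : nat := #|~: nbhd e u|.

Lemma degree_codegree u : degree e u + codegree u = #|T|.
Proof. exact: cardsC. Qed.

Lemma leq_degree_codegree u v :
  (degree e u <= degree e v) = (codegree v <= codegree u).
Proof. by have := degree_codegree u; have := degree_codegree v; lia. Qed.

Lemma common_nbhd0 : common_nbhd e set0 = setT.
Proof. by rewrite /common_nbhd big_set0. Qed.

Lemma common_nbhdU1 v (U : {set T}) :
  common_nbhd e (v |: U) = nbhd e v :&: common_nbhd e U.
Proof.
apply/setP => w; rewrite inE; apply/bigcapP/andP => [h|[wv /bigcapP h] x].
  by split; [apply: h; rewrite setU11 | apply/bigcapP => x xU; apply: h;
    rewrite inE xU orbT].
by rewrite in_setU1 => /orP[/eqP->|/h].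
Qed.

Lemma greedy_from_exists (U : {set T}) : exists s, greedy_from e U s.
Proof.
have [k] := ubnP #|common_nbhd e U|; elim: k U => // k IH U ltk.
have [C0|[w wC]] := set_0Vmem (common_nbhd e U).
  by exists [::]; rewrite /= C0.
have [v vC vmax] := @arg_maxnP _ w
  (fun u => u \in common_nbhd e U) (degree e) wC.
have [|s gs] := IH (v |: U).
  rewrite common_nbhdU1 -ltnS; apply: leq_trans ltk; rewrite ltnS.
  apply/proper_card/properP; split; first exact: subsetIr.
  by exists v => //; rewrite !inE eirr.
exists (v :: s); rewrite /= gs andbT /greedy_choice vC /=.
by apply/forall_inP.
Qed.

Lemma card_common_nbhd_le v (U : {set T}) :
  #|common_nbhd e U| <= codegree v + #|common_nbhd e (v |: U)|.
Proof.
rewrite common_nbhdU1 -(cardsID (nbhd e v)) addnC setIC leq_add2r.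
by apply: subset_leq_card; rewrite setDE subsetIr.
Qed.

(** When the algorithm stops, every vertex of [common_nbhd e U] is a non-neighbour of some term.
    This later forces the sequence to be long. *)
Lemma greedy_cover (U : {set T}) s :
  greedy_from e U s -> #|common_nbhd e U| <= \sum_(w <- s) codegree w.
Proof.
elim: s U => [|v s IH] U /=; first by move/eqP->; rewrite cards0.
case/andP=> _ /IH; rewrite big_cons => h.
by apply: leq_trans (card_common_nbhd_le v U) _; rewrite leq_add2l.
Qed.

Lemma greedy_mem_common (U : {set T}) p v t :
  greedy_from e U (p ++ v :: t) -> v \in common_nbhd e U.
Proof.
elim: p U => [|w p IH] U /= /andP[]; first by case/andP.
by move=> _ /IH; rewrite common_nbhdU1 inE => /andP[].
Qed.

Lemma greedy_codegree_le (U : {set T}) p v t :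
  greedy_from e U (p ++ v :: t) -> {in p, forall w, codegree w <= codegree v}.
Proof.
elim: p U => [|w p IH] U //= /andP[/andP[_ /forall_inP wmax] g] u.
rewrite inE => /orP[/eqP->|]; last exact: IH g u.
rewrite -leq_degree_codegree; apply: wmax.
by have := greedy_mem_common g; rewrite common_nbhdU1 inE => /andP[].
Qed.

(** The charging inequality, for arbitrary [U] to allow induction on [p]; the subtracted product is
    moved to the right to avoid truncation. *)
Lemma greedy_sum_codegree (U : {set T}) p v t :
  greedy_from e U (p ++ v :: t) ->
  \sum_(w <- p) codegree w ^ 2 + #|common_nbhd e U| * codegree v <=
  \sum_(u in common_nbhd e U) codegree u
    + (\sum_(w <- p) codegree w) * codegree v.
Proof.
elim: p U => [|w p IH] U.
  rewrite !big_nil /= => /andP[/andP[_ /forall_inP vmax] _].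
  rewrite add0n addn0 -sum_nat_const; apply: leq_sum => u uC.
  by rewrite -leq_degree_codegree vmax.
move=> g; have wv : codegree w <= codegree v.
  by apply: (greedy_codegree_le (p := w :: p) g); rewrite inE eqxx.
move: g => /= /andP[/andP[_ /forall_inP wmax] /IH {IH}].
rewrite common_nbhdU1 !big_cons setIC => IH.
have := card_common_nbhd_le w U; rewrite common_nbhdU1 setIC.
rewrite -(cardsID (nbhd e w) (common_nbhd e U)) addnC leq_add2r => kw.
rewrite [\sum_(u in common_nbhd e U) _](big_setID (nbhd e w)) /=.
have : #|common_nbhd e U :\: nbhd e w| * codegree w <=
    \sum_(u in common_nbhd e U :\: nbhd e w) codegree u.
  rewrite -sum_nat_const; apply: leq_sum => u; rewrite inE => /andP[_ uC].
  by rewrite -leq_degree_codegree wmax.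
(* With a, b the codegrees of [w], [v] and k the number of vertices charged to [w], this is (a -
   k)(b - a) >= 0. *)
have : codegree w ^ 2 + #|common_nbhd e U :\: nbhd e w| * codegree v <=
    #|common_nbhd e U :\: nbhd e w| * codegree w + codegree w * codegree v.
  by nia.
lia.
Qed.

End Greedy.

(** * Total codegrees *)

Lemma sum_turan_codegree r n : 0 < r ->
  \sum_i codegree (turan_rel r n) i
    = r * (n %/ r) ^ 2 + (n %% r) * (2 * (n %/ r) + 1).
Proof.
move=> r0.
have codE i : codegree (turan_rel r n) i = #|[set j : 'I_n | j %% r == i %% r]|.
  by apply: eq_card => j; rewrite !inE /turan_rel negbK eq_sym.
pose cl (i : 'I_n) : 'I_r := Ordinal (ltn_pmod i r0).
rewrite (partition_big cl xpredT) //=.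
(* A class of size a contributes a vertices of codegree a. *)
transitivity (\sum_(k < r) (n %/ r + (k < n %% r)) ^ 2).
  apply: eq_bigr => k _; rewrite -(turan_part_size n (ltn_ord k)) expnS expn1.
  rewrite -sum_nat_const; apply: eq_big => [i|i /eqP <-]; first by rewrite inE.
  by rewrite codE.
have sm : n %% r <= r by rewrite ltnW // ltn_mod.
transitivity (\sum_(k < r) ((n %/ r) ^ 2 + (k < n %% r) * (2 * (n %/ r) + 1))).
  by apply: eq_bigr => k _; case: (_ < _); nia.
rewrite big_split /= sum_nat_const card_ord -big_distrl /=; congr (_ + _ * _).
rewrite -(big_mkord xpredT (fun k => (k < n %% r) : nat)).
rewrite (big_cat_nat (n := n %% r)) //=.
rewrite (eq_big_nat _ _ (F2 := fun=> 1)); last by move=> i /andP[_ ->].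
rewrite sum_nat_const_nat big_nat_cond big1 ?addn0 ?subn0 ?muln1 //.
by move=> i /andP[/andP[h _] _]; rewrite ltnNge h.
Qed.

Lemma sum_codegree (T : finType) (e : rel T) :
  symmetric e -> irreflexive e ->
  2 * num_edges e + \sum_u codegree e u = #|T| ^ 2.
Proof.
move=> esym eirr; rewrite -sum_degree // -big_split /=.
by rewrite (eq_bigr _ (fun u _ => degree_codegree e u)) sum_nat_const.
Qed.

(** * Numerical inequalities *)

(** Termwise (x - q)(x - q - 1) >= 0, as no integer lies strictly between q and q + 1. *)
Lemma sum_sqr_tangent (q : nat) (a : seq nat) :
  (2 * q + 1) * \sum_(x <- a) x <= \sum_(x <- a) x ^ 2 + size a * (q * q.+1).
Proof.
elim: a => [|x a IH]; first by rewrite !big_nil muln0.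
rewrite !big_cons /=.
have : (2 * q + 1) * x <= x ^ 2 + q * q.+1 by case: (leqP x q) => ?; nia.
lia.
Qed.

Lemma sqr_sum_le (a : seq nat) :
  (\sum_(x <- a) x) ^ 2 <= size a * \sum_(x <- a) x ^ 2.
Proof.
elim: a => [|x a IH]; first by rewrite !big_nil.
rewrite !big_cons /=.
suff : 2 * (x * \sum_(y <- a) y) <= size a * x ^ 2 + \sum_(y <- a) y ^ 2 by nia.
elim: a {IH} => [|y a IH]; first by rewrite !big_nil muln0.
rewrite !big_cons /=.
by have [+ _] := nat_Cauchy x y; nia.
Qed.

(* X and S2 are the sums of the first j codegrees and of their squares, x is
   the next codegree and C the sum of all codegrees. *)
Lemma greedy_step_bound q r s j n X x S2 C :
  0 < q -> s < r -> j < r -> n = r * q + s ->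
  X <= j * q + (j + s - r) -> (2 * q + 1) * X <= S2 + j * (q * q.+1) ->
  S2 + n * x <= C + X * x -> C <= r * q ^ 2 + s * (2 * q + 1) ->
  X + x <= j.+1 * q + (j.+1 + s - r).
Proof.
move=> q0 sr jr -> XY tangent greedy CQ; rewrite leqNgt; apply/negP => gtY.
rewrite mulnA in tangent.
(* In the first case the [j.+1] smallest classes all have size [q]; in the second the last of them
   has size [q.+1]. In both, [z] is the slack in [XY] and [N] is n - X. *)
have [jsr|rjs] := ltnP (j + s) r.
  have [z zE] : exists z, j * q = X + z by exists (j * q - X); lia.
  have [k kE] : exists k, r = j + s + 1 + k by exists (r - (j + s + 1)); lia.
  pose N := (s + 1 + k) * q + z + s.
  have Nx : S2 + N * x <= C.
    have NE : r * q + s = X + N by rewrite /N kE; lia.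
    by move: greedy; rewrite NE mulnDl; lia.
  have /leq_trans/(_ Nx) : S2 + N * (q + 1 + z) <= S2 + N * x.
    by rewrite leq_add2l leq_mul2l; apply/orP; right; lia.
  have rqE : r * q ^ 2 = (X + z) * q + (s + 1 + k) * q ^ 2.
    by rewrite -zE kE; ring.
  (* The hypotheses bound the left side by all but the last summand on the right, which is positive
     by [q0]. *)
  have : (2 * q + 1) * X + N * (q + 1 + z) =
    (X + z) * q.+1 + ((X + z) * q + (s + 1 + k) * q ^ 2 + s * (2 * q + 1))
      + ((1 + k) * q + z * ((s + k) * q + s + z)) by rewrite /N; ring.
  rewrite zE in tangent; rewrite rqE in CQ.
  lia.
have [t tE] : exists t, j + s = r + t by exists (j + s - r); lia.
have [z zE] : exists z, j * q + t = X + z by exists (j * q + t - X); lia.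
have [k kE] : exists k, r = j + 1 + k by exists (r - (j + 1)); lia.
have sE : s = t + 1 + k by lia.
pose N := (1 + k) * q.+1 + z.
have Nx : S2 + N * x <= C.
  have NE : r * q + s = X + N by rewrite /N kE sE; lia.
  by move: greedy; rewrite NE mulnDl; lia.
have /leq_trans/(_ Nx) : S2 + N * (q + 2 + z) <= S2 + N * x.
  by rewrite leq_add2l leq_mul2l; apply/orP; right; lia.
have CE : j * q * q.+1 + (r * q ^ 2 + s * (2 * q + 1))
    = (2 * q + 1) * (X + z) + (1 + k) * q.+1 ^ 2.
  by rewrite -zE kE sE; ring.
have : (2 * q + 1) * X + N * (q + 2 + z) =
  (2 * q + 1) * (X + z) + (1 + k) * q.+1 ^ 2
    + ((1 + k) * q.+1 + z * (k * q + k + z + 2)) by rewrite /N; ring.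
lia.
Qed.

(** Used with k = r - 1 and [leC] the negation of the desired inequality: the first k codegrees must
    then average to the last one. *)
Lemma greedy_final_bound k n X x S2 C :
  X ^ 2 <= k * S2 -> S2 + n * x <= C + X * x -> k.+1 * C <= n * (X + x) ->
  X + x <= n -> X <= k * x -> X = k * x.
Proof.
move=> cauchy greedy leC Xn Xx; apply/eqP; rewrite eqn_leq Xx leqNgt /=.
apply/negP => ltX.
have [D DE] : exists D, k * x = X + D by exists (k * x - X); lia.
have [y yE] : exists y, n = X + x + y by exists (n - (X + x)); lia.
have S2x : S2 + (x + y) * x <= C by rewrite yE in greedy; lia.
have {}leC : k * (k.+1 * (S2 + (x + y) * x)) <= k * (n * (X + x)).
  rewrite leq_mul2l (leq_trans _ leC) ?orbT //.
  by rewrite leq_mul2l S2x orbT.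
have {}cauchy : k.+1 * X ^ 2 <= k.+1 * (k * S2) by rewrite leq_mul2l cauchy orbT.
(* By Cauchy-Schwarz, k (k.+1 S2 + k.+1 (n - X) x - n (X + x))
   >= (k x - X) (k n - k.+1 X) = D (D + k y) *)
have lE : k * (k.+1 * (S2 + (x + y) * x))
    = k.+1 * (k * S2) + (k * x + x + k.+1 * y) * (k * x) by ring.
have rE : k * (n * (X + x))
    = X * (k * X + k * x) + (k * x) * (X + x) + y * (k * X + k * x).
  by rewrite yE; ring.
have : k.+1 * X ^ 2 + (X + D + x + k.+1 * y) * (X + D)
    = X * (k * X + (X + D)) + (X + D) * (X + x) + y * (k * X + (X + D))
      + D * (D + k * y) by ring.
move: leC; rewrite lE rE DE.
have : 0 < D * (D + k * y) by rewrite muln_gt0 addn_gt0; lia.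
lia.
Qed.

(** * Partial sums of codegrees along a greedy sequence *)

Section PartialSums.
Variables (T : finType) (e : rel T) (r : nat).
Hypotheses (r_gt0 : 0 < r) (rT : r <= #|T|).
Let q := #|T| %/ r.
Let m := #|T| %% r.
Hypothesis codegT : \sum_u codegree e u <= r * q ^ 2 + m * (2 * q + 1).

(* The bound is the total size of the j smallest classes of the Turan graph:
   r - m classes have size q, the other m have size q + 1. *)
Lemma sum_take_codegree s j : P_sequence e s -> j <= r ->
  (j <= size s) /\ \sum_(w <- take j s) codegree e w <= j * q + (j + m - r).
Proof.
move=> gs; have q0 : 0 < q by rewrite divn_gt0.
have mr : m < r by rewrite ltn_mod.
have TE : #|T| = r * q + m by rewrite [LHS](divn_eq _ r) mulnC.
elim: j => [|j IH] jr; first by rewrite take0 big_nil.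
have [js XY] := IH (ltnW jr).
have ltjs : j < size s.
  (* A sequence stopping after [j] terms would give [#|T| <= j * q + (j + m - r)], which is less
     than [r * q + m]. *)
  rewrite ltn_neqAle js andbT; apply/eqP => jE.
  have := greedy_cover gs; rewrite common_nbhd0 cardsT.
  move: XY; rewrite jE take_size -jE; nia.
split=> // {IH}; case: s => [//|v0 s'] in gs js XY ltjs *.
set s := v0 :: s' in gs js XY ltjs *.
rewrite (take_nth v0) // -cats1 big_cat big_seq1 /=.
move: gs; rewrite /P_sequence -{1}(cat_take_drop j s) (drop_nth v0) //.
move/greedy_sum_codegree; rewrite common_nbhd0 cardsT.
rewrite [\sum_(u in _) _](eq_bigl xpredT) => [greedy|u]; last by rewrite inE.
apply: greedy_step_bound greedy codegT => //.
have := sum_sqr_tangent q [seq codegree e w | w <- take j s].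
by rewrite !big_map size_map size_take ltjs.
Qed.

Lemma sum_codegree_lt s : 1 < r -> P_sequence e s -> ~ regular e ->
  #|T| * \sum_(w <- take r s) codegree e w < r * \sum_u codegree e u.
Proof.
move=> r1 gs nreg.
have mr : m < r by rewrite ltn_mod.
have TE : #|T| = r * q + m by rewrite [LHS](divn_eq _ r) mulnC.
have [rs Xr] := sum_take_codegree gs (leqnn r).
case: s => [|v0 s'] in gs rs Xr *; first by rewrite leqNgt r_gt0 in rs.
rewrite ltnNge; apply/negP => leC; apply: nreg; exists (degree e v0).
set s := v0 :: s' in gs rs Xr leC.
have rs' : r.-1 < size s by rewrite prednK.
move: gs; rewrite /P_sequence -{1}(cat_take_drop r.-1 s) (drop_nth v0) //.
move=> gs; have := greedy_sum_codegree gs.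
have le_x := greedy_codegree_le gs.
have min0 : forall u, codegree e v0 <= codegree e u.
  move: gs; rewrite -drop_nth // cat_take_drop /= => /andP[/andP[_]].
  by rewrite common_nbhd0 => /forall_inP h _ u; rewrite -leq_degree_codegree h.
rewrite common_nbhd0 cardsT.
rewrite [\sum_(u in _) _](eq_bigl xpredT) => [greedy|u]; last by rewrite inE.
set x := codegree e (nth v0 s r.-1) in greedy le_x *.
set p := take r.-1 s in greedy le_x *.
set C := \sum_u _ in greedy leC *; set X := \sum_(w <- p) codegree e w in greedy *.
have szp : size p = r.-1 by rewrite size_take rs'.
have sumE : \sum_(w <- take r s) codegree e w = X + x.
  have -> : take r s = rcons p (nth v0 s r.-1) by rewrite -take_nth // prednK.
  by rewrite -cats1 big_cat big_seq1.
rewrite sumE in leC Xr.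
have Xn : X + x <= #|T| by apply: leq_trans Xr _; lia.
have Xx : X <= r.-1 * x.
  rewrite -szp -sum1_size big_distrl /= /X big_seq [leqRHS]big_seq.
  by apply: leq_sum => w /le_x; rewrite mul1n.
have XE : X = r.-1 * x.
  rewrite -[r in r * C](prednK r_gt0) in leC.
  apply: greedy_final_bound greedy leC Xn Xx.
  have := sqr_sum_le [seq codegree e w | w <- p].
  by rewrite !big_map size_map szp.
(* As r >= 2, the first term lies in [p]; all terms of [p] are at most [x] in codegree and average
   to [x], so [v0] has codegree [x]. *)
have [p' pE] : exists p', p = v0 :: p'.
  by exists (take r.-2 s'); rewrite /p /s; case: (r) r1 => [|[]].
have x0 : codegree e v0 = x.
  apply/eqP; rewrite eqn_leq min0 /=.
  have : X <= codegree e v0 + size p' * x.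
    rewrite /X pE big_cons leq_add2l -sum1_size big_distrl /= big_seq.
    rewrite [leqRHS]big_seq; apply: leq_sum => w wp; rewrite mul1n.
    by apply: le_x; rewrite pE inE wp orbT.
  by move: szp; rewrite pE /= XE => <-; nia.
(* The mean codegree is at most the minimum [x], so all codegrees equal [x]. *)
have Cx : C <= #|T| * x by move: leC; rewrite XE; nia.
move=> u; suff : codegree e u = codegree e v0.
  by have := degree_codegree e u; have := degree_codegree e v0; lia.
apply/eqP; rewrite eqn_leq min0 andbT.
have : C = codegree e u + \sum_(w | w != u) codegree e w by rewrite /C (bigD1 u).
have : \sum_(w | w != u) codegree e v0 <= \sum_(w | w != u) codegree e w.
  by apply: leq_sum => w _; apply: min0.
rewrite sum_nat_const cardC1 x0.
by move: Cx; rewrite -{1}(ltn_predK (leq_trans r_gt0 rT)) mulSn; lia.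
Qed.

End PartialSums.

(** * Return from codegrees to degrees *)

Local Open Scope ring_scope.

Theorem theorem2 (r n m : nat) (hr : (2 <= r)%N) (hn : (r <= n)%N)
    (hm : (turan_number r n <= m)%N)
    (T : finType) (e : rel T) (esym : symmetric e) (eirr : irreflexive e)
    (hT : #|T| = n) (hE : num_edges e = m) (hreg : ~ regular e) :
  exists s : seq T,
    [/\ P_sequence e s,
        (r <= size s)%N &
        2%:R * r%:R * m%:R / n%:R
          < \sum_(v <- take r s) (degree e v)%:R :> rat].
Proof.
have r0 : (0 < r)%N by apply: ltnW.
have [s gs] := greedy_from_exists eirr set0.
have sumE := sum_codegree esym eirr.
have codegT : (\sum_u codegree e u <= r * (#|T| %/ r) ^ 2
    + (#|T| %% r) * (2 * (#|T| %/ r) + 1))%N.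
  (* Both graphs satisfy 2 * edges + total codegree = n^2, so [hm] bounds the total codegree by that
     of the Turan graph. *)
  rewrite -sum_turan_codegree // hT.
  have : symmetric (turan_rel r n) by move=> i j; rewrite /turan_rel eq_sym.
  move/sum_codegree => /(_ (fun i => negbF (eqxx _))).
  by rewrite card_ord -/(turan_number r n); lia.
have rT : (r <= #|T|)%N by rewrite hT.
have [rs _] := sum_take_codegree r0 rT codegT gs (leqnn r).
exists s; split=> //.
have lt := sum_codegree_lt r0 rT codegT hr gs hreg.
have sE : (\sum_(v <- take r s) degree e v + \sum_(v <- take r s) codegree e v
           = r * n)%N.
  rewrite -big_split /= (eq_bigr _ (fun u _ => degree_codegree e u)) hT.
  by rewrite big_const_seq count_predT size_takel // iter_addn_0 mulnC.
have n0 : (0 < n)%N by apply: leq_trans hn.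
rewrite ltr_pdivrMr ?ltr0n // -natr_sum -!natrM ltr_nat.
rewrite hT hE in lt sumE.
have : (n * (\sum_(v <- take r s) degree e v
  + \sum_(v <- take r s) codegree e v) = n * (r * n))%N by rewrite sE.
have : (r * (2 * m + \sum_u codegree e u) = r * n ^ 2)%N by rewrite sumE.
lia.
Qed.
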